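(* Let $s\ge 1$ be an integer, $C>1$ and $$\delta<\frac{(C-1)^2}{4C}.$$ For each sufficiently large integer $N$ let $S\subset G=\mathbb{Z}/N\mathbb{Z}$ be a fixed set with $|S|=s$, and let $\Omega$ be a random subset of $\mathbb{Z}/N\mathbb{Z}$ obtained by random selection of parameter $\tau$, where $$E(|\Omega|)=\tau N=(3s+2)\,C\log N .$$ Then the probability of the event (ii) for every $z:G\to\mathbb{C}$, $z\neq 0$, with $\hat z|_\Omega=0$, one has $\sum_{t\in G\setminus S}|z(t)|>\sum_{t\in S}|z(t)|$ satisfies $$P(\text{(ii)})=1-O(N^{-\delta})\qquad (N\to\infty),$$ i.e. there is a constant $A$ (depending only on $s,C,\delta$) such that $P(\text{(ii)})\ge 1-AN^{-\delta}$ for all sufficiently large $N$.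
   Context: For $z:G\to\mathbb{C}$, $\hat z(\omega)=\frac1{\sqrt N}\sum_{t\in G}z(t)\exp(-2\pi i t\omega/N)$ for $\omega\in\mathbb{Z}/N\mathbb{Z}$. ''Random selection of parameter $\tau\in(0,1)$ on $\mathbb{Z}/N\mathbb{Z}$'' means that the events $(n\in\Omega)$, $n\in\mathbb{Z}/N\mathbb{Z}$, are independent and each has probability $\tau$. $\log$ is the natural logarithm; $N$ is large enough that $\tau<1$. *)

(* Defs.v *)
From HB Require Import structures.
From mathcomp Require Import all_boot all_order all_algebra.
From mathcomp Require Import all_classical all_reals all_analysis.
From mathcomp Require Import complex.

Set Implicit Arguments.
Unset Strict Implicit.
Unset Printing Implicit Defensive.

Import Order.TTheory GRing.Theory Num.Theory.

Local Open Scope classical_set_scope.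
Local Open Scope complex_scope.
Local Open Scope ring_scope.

Definition cis (R : realType) (x : R) : R[i] := cos x +i* sin x.

(* Unitary discrete Fourier transform on Z/NZ.  The residues t and w are read
   through their representatives in {0, ..., N-1}; their product is taken
   in R, the value being independent of the representatives.  'Z_N is Z/NZ only
   for 1 < N. *)
Definition dft (R : realType) (N : nat) (z : {ffun 'Z_N -> R[i]})
    (w : 'Z_N) : R[i] :=
  ((Num.sqrt (N%:R : R))^-1)%:C *
  \sum_(t : 'Z_N)
    z t * cis (- (2 * pi * (t : nat)%:R * (w : nat)%:R / N%:R)).

(* The order and the norm are those of R[i]: both sums are nonnegative reals,
   on which the partial order of R[i] is that of R. *)
Definition null_space_property (R : realType) (N : nat)
    (S Omega : {set 'Z_N}) : Prop :=
  forall z : {ffun 'Z_N -> R[i]},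
    z != 0 -> (forall w, w \in Omega -> dft z w = 0) ->
    \sum_(t in S) `|z t| < \sum_(t in ~: S) `|z t|.

Definition mutually_independent (R : realType) (d : measure_display)
    (T : measurableType d) (P : probability T R) (I : finType)
    (E : I -> set T) : Prop :=
  forall J : {set I},
    P (\bigcap_(i in [set` J]) E i) = (\prod_(i in J) P (E i))%E.

Definition random_selection (R : realType) (d : measure_display)
    (T : measurableType d) (P : probability T R) (N : nat)
    (tau : R) (Omega : T -> {set 'Z_N}) : Prop :=
  let E (n : 'Z_N) : set T := [set x | n \in Omega x] in
  [/\ 0 < tau < 1,
      forall n, measurable (E n),
      forall n, P (E n) = tau%:E
    & mutually_independent P E].

(* Main.v *)
(** Write chi_t(n) = exp(-2 pi i t n / N) and k(t, u) = sum_(n in Omega)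
    chi_u(n) conj(chi_t(n)).  If the transform of z vanishes on Omega then
    sum_u z(u) k(t, u) = 0, hence |Omega| |z(t)| <= sum_(u != t) |k(t, u)| |z(u)|;
    summing over t in S, the null space property holds as soon as, for some
    0 < a <= 1,
      sum_(t in S) |k(t, u)| < a tau N                        for u outside S,
      sum_(t in S, t != u) |k(t, u)| < |Omega| - a tau N      for u in S.
    Each modulus |w| is bounded by the maximum of Re (e w) over e in a finite
    set of complex numbers of modulus at most 1 + eta, independent of N.  The
    left sides are thus bounded by maxima of boundedly many sums over Omega of
    functions f with sum_n f(n)^2 <= N s (1 + eta)^2.  As exp x <= 1 + x + 3/4 x^2
    for x <= 2/3, Chernoff's method bounds the probability that such a sum
    exceeds its mean by b tau N by exp (- b^2 tau N / (3 s + 2)) = N^(- C b^2).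
    The N points u outside S require b = a and the s points of S require
    b = 1 - a; with a = (C + 1) / (2 C) and delta_0 = (C - 1)^2 / (4 C) one has
    C a^2 = 1 + delta_0 and C (1 - a)^2 = delta_0, so both contributions are
    O(N^(- delta_0)). *)

Require Import Defs.
From HB Require Import structures.
From mathcomp Require Import all_boot all_order all_algebra.
From mathcomp Require Import all_classical all_reals all_analysis.
From mathcomp Require Import complex.
From mathcomp Require Import ring lra.

Set Implicit Arguments.
Unset Strict Implicit.
Unset Printing Implicit Defensive.

Import Order.TTheory GRing.Theory Num.Theory.
Import numFieldNormedType.Exports.
Import Normc.

Local Open Scope classical_set_scope.
Local Open Scope complex_scope.
Local Open Scope ring_scope.

(* The function exp(-x) (1 + x + 3/4 x^2) has derivative
   exp(-x) (x/2) (1 - 3x/2), so its minimum on x <= 2/3 is its value 1 at 0. *)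
Lemma expR_le_quadratic (R : realType) (x : R) :
  x <= 2 / 3 -> expR x <= 1 + x + 3 / 4 * x ^+ 2.
Proof.
move=> x23.
pose g (y : R) : R := expR (- y) * (1 + y + 3 / 4 * y ^+ 2).
have dg y : is_derive y (1 : R) g (expR (- y) * (y / 2 * (1 - 3 / 2 * y))).
  rewrite /g; apply: is_derive_eq.
  by rewrite /GRing.scale/=; field.
have cg (A : set R) : {within A, continuous g}%classic.
  apply: continuous_subspaceT => z.
  by apply: differentiable_continuous; apply/derivable1_diffP; case: (dg z).
have g'E y : g^`()%classic y = expR (- y) * (y / 2 * (1 - 3 / 2 * y)).
  by rewrite derive1E; case: (dg y).
suff : 1 <= g x.
  by rewrite /g mulrC -ler_pdivrMr ?expR_gt0// expRN invrK mul1r.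
have <- : g 0 = 1 by rewrite /g oppr0 expR0; ring.
have [x0|x0] := leP 0 x.
- apply: (@ger0_derive1_ndecr _ g 0 (2 / 3)) => //.
  move=> y; rewrite in_itv/= => /andP[y0 y1]; rewrite g'E.
  by rewrite mulr_ge0 ?expR_ge0// mulr_ge0//; lra.
- apply: (@ler0_derive1_nincr _ g x 0) => //; last by rewrite ltW.
  move=> y; rewrite in_itv/= => /andP[y0 y1]; rewrite g'E.
  by rewrite mulr_ge0_le0 ?expR_ge0// mulr_le0_ge0//; lra.
Qed.

(** * Distribution and exponential moments of a random subset of a finite type *)

Section FiniteLaw.
Context {R : realType} {d : measure_display} {T : measurableType d}.
Variables (P : probability T R) (I : finType) (X : T -> {set I}).

Definition law (A : {set I}) : R := fine (P [set x | X x = A]).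

Lemma law_ge0 A : 0 <= law A.
Proof. by rewrite fine_ge0. Qed.

Hypothesis mX : forall i, measurable [set x | i \in X x].

Lemma measurable_law A : measurable [set x | X x = A].
Proof.
have -> : [set x | X x = A] = \bigcap_(i in [set: I])
    (if i \in A then [set x | i \in X x] else ~` [set x | i \in X x]).
  apply/seteqP; split => [x /= <- i _|x /= h].
    by case: ifPn => // /negP.
  by apply/setP => i; have := h i Logic.I; case: ifP => _ // /negP/negbTE.
apply: fin_bigcap_measurable; first exact: finite_finset.
by move=> i _; case: ifP => _ //; apply: measurableC.
Qed.

Lemma law_pred (Q : pred {set I}) :
  P [set x | Q (X x)] = (\sum_(A | Q A) law A)%:E.
Proof.
have -> : [set x | Q (X x)] =
    \bigcup_(A in [set` Q]) [set x | X x = A].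
  by apply/seteqP; split => [x /= Qx|x /= [A /= QA ->//]]; exists (X x).
rewrite measure_fin_bigcup.
- rewrite -sumEFin [RHS]bigfs ?index_enum_uniq//.
    apply: eq_fsbigr => A _; rewrite /law fineK//.
    exact: (fin_num_measure P _ (measurable_law A)).
  by move=> A _; rewrite mem_index_enum.
- exact: finite_finset.
- by move=> A B _ _ [x [/= <- <-]].
- by move=> A _; apply: measurable_law.
Qed.

Variable tau : R.
Hypotheses (PX : forall i, P [set x | i \in X x] = tau%:E)
  (indX : mutually_independent P (fun i => [set x | i \in X x])).

(** Independence enters all later estimates only through this identity. *)
Lemma law_superset (J : {set I}) : \sum_(A : {set I} | J \subset A) law A = tau ^+ #|J|.
Proof.
apply: EFin_inj; rewrite -(law_pred (fun A : {set I} => J \subset A)).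
have -> : [set x | J \subset X x] = \bigcap_(i in [set` J]) [set x | i \in X x].
  by apply/seteqP; split => x /=; [move/fintype.subsetP|move=> ?; apply/fintype.subsetP].
rewrite indX; under eq_bigr do rewrite PX.
by rewrite prodEFin prodr_const.
Qed.

Lemma law_total : \sum_(A : {set I}) law A = 1.
Proof.
rewrite -[RHS](expr0 tau) -(cards0 I) -law_superset.
by apply: eq_bigl => A; rewrite finset.sub0set.
Qed.

(* With g i = exp (f i) - 1, prod_(i in A) (1 + g i) is the sum over the
   subsets J of A of prod_(i in J) g i, whose expectation only involves
   the probabilities of the events J \subset X. *)
Lemma law_expR_sum (f : I -> R) :
  \sum_(A : {set I}) law A * expR (\sum_(i in A) f i) = \prod_i (1 + tau * (expR (f i) - 1)).
Proof.
pose g i := expR (f i) - 1.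
have subE (A : {set I}) :
    expR (\sum_(i in A) f i) = \sum_(J : {set I} | J \subset A) \prod_(i in J) g i.
  rewrite expR_sum big_mkcond/=.
  under eq_bigr => i _.
    rewrite (_ : (if _ then _ else _) = (if i \in A then g i else 0) + 1).
      over.
    by rewrite /g; case: ifP => _; ring.
  rewrite bigA_distr [RHS]big_mkcond/=; apply: eq_bigr => J _.
  case: ifPn => [/fintype.subsetP JA|/fintype.subsetPn[i iJ iA]].
    rewrite [RHS]big_mkcond; apply: eq_bigr => i _.
    by case: ifPn => // /JA ->.
  by rewrite (bigD1 i)//= iJ (negbTE iA) mul0r.
under [LHS]eq_bigr do rewrite subE mulr_sumr.
rewrite (exchange_big_dep xpredT)//=.
under [RHS]eq_bigr do rewrite addrC.
rewrite bigA_distr; apply: eq_bigr => J _.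
rewrite -mulr_suml law_superset -prodr_const -big_split/=.
by rewrite big_mkcond.
Qed.

Lemma law_chernoff (f : I -> R) (l a : R) : 0 < tau -> 0 <= l ->
  (forall i, l * f i <= 2 / 3) ->
  \sum_(A : {set I} | a <= \sum_(i in A) f i) law A <=
  expR (tau * (l * \sum_i f i + 3 / 4 * l ^+ 2 * \sum_i f i ^+ 2) - l * a).
Proof.
move=> tau0 l0 lf.
(* Markov's inequality: on the event, [expR (l * (\sum_(i in A) f i - a))] is at least 1. *)
apply: (@le_trans _ _
  (expR (- (l * a)) * \sum_(A : {set I}) law A * expR (\sum_(i in A) l * f i))).
  rewrite big_mkcond/= mulr_sumr; apply: ler_sum => A _.
  rewrite mulrCA -expRD -mulr_sumr; case: ifP => aA; last first.
    by rewrite mulr_ge0 ?law_ge0 ?expR_ge0.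
  rewrite ler_peMr ?law_ge0// -expR0 ler_expR addrC subr_ge0.
  exact: ler_wpM2l.
rewrite law_expR_sum [X in _ <= expR X]addrC expRD ler_pM2l ?expR_gt0//.
rewrite !mulr_sumr -big_split/= mulr_sumr expR_sum.
apply: ler_prod => i _; apply/andP; split.
  (* Comparing products factorwise requires nonnegative factors; here the factor is
     [1 - tau + tau * expR (l * f i)]. *)
  have t1 : tau <= 1.
    rewrite -lee_fin -(PX i); exact: probability_le1.
  rewrite mulrBr mulr1 addrA addrAC addr_ge0 ?subr_ge0//.
  by rewrite mulr_ge0 ?expR_ge0// ltW.
apply: le_trans (expR_ge1Dx _).
rewrite lerD2l ler_pM2l//.
have := expR_le_quadratic (lf i).
by rewrite exprMn; lra.
Qed.

End FiniteLaw.

(** * The real-valued modulus on [R[i]] *)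

Section ComplexNorm.
Context {R : realType}.
Implicit Types x y : R[i].

Lemma norm_normc x : `|x| = (normc x)%:C.
Proof. by []. Qed.

Lemma normc_ge0 x : 0 <= normc x.
Proof. by case: x => a b; apply: sqrtr_ge0. Qed.

Lemma Re_le_normc x : `|complex.Re x| <= normc x.
Proof. by rewrite -lecR; apply: normc_ge_Re. Qed.

Lemma normc_conj x : normc x^* = normc x.
Proof. by case: x => a b /=; rewrite sqrrN. Qed.

Lemma normc_sqr x : (normc x ^+ 2)%:C = x * x^*.
Proof. by rewrite rmorphXn/= -norm_normc sqr_normc. Qed.

Lemma normc_sum (I : Type) (r : seq I) (Q : pred I) (F : I -> R[i]) :
  normc (\sum_(i <- r | Q i) F i) <= \sum_(i <- r | Q i) normc (F i).
Proof.
elim/big_rec2: _ => [|i y x _ xy]; first by rewrite normc0.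
by apply: le_trans (le_normcD _ _) _; rewrite lerD2l.
Qed.

Lemma ReD x y : complex.Re (x + y) = complex.Re x + complex.Re y.
Proof. by case: x y => [a b] [c e]. Qed.

Lemma Re_sum (I : Type) (r : seq I) (Q : pred I) (F : I -> R[i]) :
  complex.Re (\sum_(i <- r | Q i) F i) = \sum_(i <- r | Q i) complex.Re (F i).
Proof. exact: (big_morph (@complex.Re R) ReD). Qed.

End ComplexNorm.

(** * Finite sets of multipliers that recover the modulus *)

Lemma truncn_approx (R : realType) (M : nat) (x : R) : (0 < M)%N -> 0 <= x ->
  0 <= x - (Num.truncn (x * M%:R))%:R / M%:R <= 1 / M%:R.
Proof.
move=> M0 x0; have M0' : 0 < M%:R :> R by rewrite ltr0n.
have /truncn_itv/andP[h1 h2] : 0 <= x * M%:R by rewrite mulr_ge0// ltW.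
rewrite subr_ge0 ler_pdivrMr// h1/= lerBlDr -mulrDl ler_pdivlMr//.
by rewrite nat1r ltW.
Qed.

(* Rounding down (1 + 2/M) conj(w)/|w| to the grid of mesh 1/M loses
   at most 2/M. *)
Lemma finite_norming_set (R : realType) (eta : R) : 0 < eta ->
  exists (D : finType) (e : D -> R[i]), (0 < #|D|)%N /\
    (forall i, normc (e i) <= 1 + eta) /\
    (forall w, exists i, normc w <= complex.Re (e i * w)).
Proof.
move=> eta0; pose m := (Num.truncn (4 / eta)).+4.
pose M : R := m%:R; have M4 : 4 <= M by rewrite ler_nat.
have M0 : 0 < M by lra.
have etaM : 4 / M <= eta.
  rewrite ler_pdivrMr// mulrC -ler_pdivrMr//.
  have /truncn_itv/andP[_ h] : 0 <= 4 / eta by rewrite divr_ge0// ltW.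
  by apply: le_trans (ltW h) _; rewrite ler_nat; apply: (leq_addl 3).
have Mi0 : 0 < M^-1 by rewrite invr_gt0.
have Mi4 : M^-1 <= 1 / 4 by rewrite div1r lef_pV2// posrE.
pose L := (4 * m)%N.
pose raw (i : 'I_L.+1 * 'I_L.+1) : R[i] :=
  ((i.1 : nat)%:R / M - 2) +i* ((i.2 : nat)%:R / M - 2).
(* Grid points of too large modulus are replaced by 0, so that the bound holds for every index. *)
exists ('I_L.+1 * 'I_L.+1)%type,
  (fun i => if normc (raw i) <= 1 + eta then raw i else 0).
split; first by apply/card_gt0P; exists (ord0, ord0).
split => [i|w].
  by case: ifP => // _; rewrite normc0 addr_ge0// ltW.
have [->|w0] := eqVneq w 0.
  by exists (ord0, ord0); rewrite mulr0 normc0.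
case: w w0 => x y w0; set r := normc (x +i* y).
have r0 : 0 < r.
  rewrite lt_def normc_ge0 andbT; apply: contra w0 => /eqP.
  by move/eq0_normc => ->.
have rE : r ^+ 2 = x ^+ 2 + y ^+ 2.
  by rewrite /r/= sqr_sqrtr// addr_ge0// sqr_ge0.
pose k := 1 + 2 * M^-1; pose p := k * (x / r); pose q := - k * (y / r).
have pq : p ^+ 2 + q ^+ 2 = k ^+ 2.
  rewrite /p /q !exprMn sqrrN -mulrDr !exprVn -mulrDl -rE mulfV ?mulr1//.
  by rewrite expf_neq0// gt_eqF.
have xr : -1 <= x / r <= 1.
  rewrite -ler_norml normrM normfV (gtr0_norm r0) ler_pdivrMr// mul1r.
  exact: (Re_le_normc (x +i* y)).
have yr : -1 <= y / r <= 1.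
  rewrite -ler_norml normrM normfV (gtr0_norm r0) ler_pdivrMr// mul1r.
  rewrite -(@ler_pXn2r _ 2)// ?nnegrE ?normr_ge0 ?(ltW r0)// real_normK ?num_real//.
  by rewrite rE lerDr sqr_ge0.
have k0 : 1 <= k <= 2 by rewrite /k; lra.
have pb : -2 <= p <= 2 by rewrite /p; nra.
have qb : -2 <= q <= 2 by rewrite /q; nra.
have lt_grid (v : R) : -2 <= v <= 2 -> (Num.truncn ((v + 2) * M) < L.+1)%N.
  move=> /andP[v1 v2]; rewrite ltnS -(ler_nat R).
  rewrite (@le_trans _ _ ((v + 2) * M))//.
    by rewrite truncn_le mulr_ge0//; lra.
  by rewrite natrM ler_pM2r//; lra.
exists (Ordinal (lt_grid _ pb), Ordinal (lt_grid _ qb)).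
have ge0 (v : R) : -2 <= v <= 2 -> 0 <= v + 2 by move=> /andP[]; lra.
have /= := truncn_approx (isT : 0 < m)%N (ge0 _ pb).
have /= := truncn_approx (isT : 0 < m)%N (ge0 _ qb).
rewrite /raw/= -/M.
set a := _ / M; set b := _ / M; set h := M^-1; rewrite div1r => hb ha.
have pk : - k <= p <= k by rewrite /p; nra.
have qk : - k <= q <= k by rewrite /q; nra.
pose e := p + 2 - b; pose f := q + 2 - a.
have -> : b - 2 = p - e by rewrite /e; ring.
have -> : a - 2 = q - f by rewrite /f; ring.
have {}ha : 0 <= e <= h by [].
have {}hb : 0 <= f <= h by [].
(* The rounded point has modulus at most [k + 2 * h], that is [1 + 4 / M], so the conditional keeps
   it. *)
have -> : Num.sqrt ((p - e) ^+ 2 + (q - f) ^+ 2) <= 1 + eta.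
  apply: (@le_trans _ _ (k + 2 * h)); last by rewrite /k /h; lra.
  have kh : 0 <= k + 2 * h by lra.
  rewrite -[leRHS](ger0_norm kh) -sqrtr_sqr ler_wsqrtr//.
  have pe : - (p * e) <= k * h by nra.
  have qf : - (q * f) <= k * h by nra.
  have e2 : e ^+ 2 <= h ^+ 2 by nra.
  have f2 : f ^+ 2 <= h ^+ 2 by nra.
  have h2 := sqr_ge0 h.
  rewrite [leLHS](_ : _ = p ^+ 2 + q ^+ 2 + 2 * - (p * e) + 2 * - (q * f) +
    e ^+ 2 + f ^+ 2); last by ring.
  rewrite pq [leRHS](_ : _ = k ^+ 2 + 4 * (k * h) + 4 * h ^+ 2); last by ring.
  lra.
rewrite /=.
have pxqy : p * x - q * y = r + 2 * (h * r).
  have r0' : r != 0 by rewrite gt_eqF.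
  have -> : p * x - q * y = k * ((x ^+ 2 + y ^+ 2) / r) by rewrite /p /q; field.
  by rewrite -rE /k -/h; field.
have /andP[e0 eh] := ha; have /andP[f0 fh] := hb.
have h0 : 0 <= h by exact: ltW.
have ex : e * x <= h * r.
  have xr' : x <= r by rewrite -[r]mul1r -ler_pdivrMr//; case/andP: xr.
  by apply: (le_trans (ler_wpM2l e0 xr')); apply: ler_wpM2r (ltW r0) _ _ eh.
have fy : - (f * y) <= h * r.
  have yr' : - y <= r.
    by rewrite lerNl -mulN1r -ler_pdivlMr//; case/andP: yr.
  by rewrite -mulrN; apply: (le_trans (ler_wpM2l f0 yr')); apply: ler_wpM2r (ltW r0) _ _ fh.
rewrite [leRHS](_ : _ = (p * x - q * y) - e * x + f * y); last by ring.
by rewrite pxqy; lra.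
Qed.

(** * Characters of Z/NZ and their orthogonality *)

Section Characters.
Context {R : realType}.

Lemma cisD (x y : R) : cis (x + y) = cis x * cis y.
Proof. by rewrite /cis cosD sinD; congr (_ +i* _); rewrite addrC. Qed.

Lemma cis0 : cis (0 : R) = 1.
Proof. by rewrite /cis cos0 sin0. Qed.

Lemma cis_conj (x : R) : (cis x)^* = cis (- x).
Proof. by rewrite /cis cosN sinN. Qed.

Lemma cisX (x : R) n : cis x ^+ n = cis (x * n%:R).
Proof.
elim: n => [|n IHn]; first by rewrite mulr0 cis0.
by rewrite exprS IHn -cisD -nat1r mulrDr mulr1.
Qed.

Lemma cis_2pi_nat n : cis (2 * pi * n%:R : R) = 1.
Proof. by rewrite -cisX /cis mulr_natl cos2pi sin2pi expr1n. Qed.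

Lemma normc_cis (x : R) : normc (cis x) = 1.
Proof. by rewrite /normc/= cos2Dsin2 sqrtr1. Qed.

Lemma cis_neq1 (x : R) : 0 < `|x| < 2 * pi -> cis x != 1.
Proof.
move=> /andP[x0 x2]; apply/eqP => -[].
have <- : cos `|x| = cos x by case: ger0P => // _; rewrite cosN.
rewrite -[X in cos X](divfK (_ : 2 != 0))// mulr_natr cos_mulr2n cos2sin2 => h _.
have : 0 < sin (`|x| / 2) by apply: sin_gt0_pi; rewrite divr_gt0//=; lra.
by rewrite lt0r => /andP[/negP[]]; rewrite -sqrf_eq0; apply/eqP; lra.
Qed.

Definition chi N (t n : 'Z_N) : R[i] :=
  cis (- (2 * pi * (t : nat)%:R * (n : nat)%:R / N%:R)).

Lemma chi_conj N (t n : 'Z_N) : chi t n * (chi t n)^* = 1.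
Proof. by rewrite -normc_sqr normc_cis expr1n. Qed.

(** For [t != u] the terms are the powers of an [N]-th root of unity, which differs from 1 because
    [t - u] lies strictly between [-N] and [N]; the geometric sum vanishes. *)
Lemma chi_orthogonal N (t u : 'Z_N) : (1 < N)%N ->
  \sum_n chi u n * (chi t n)^* = if t == u then N%:R else 0.
Proof.
case: N t u => [|[|N]]// t u _; set M := N.+2 in t u *.
have M0 : M%:R != 0 :> R by rewrite pnatr_eq0.
case: eqVneq => [->|tu].
  under eq_bigr do rewrite chi_conj.
  by rewrite sumr_const card_ord.
pose th : R := 2 * pi * ((t : nat)%:R - (u : nat)%:R) / M%:R.
have wE (n : 'Z_M) : @chi M u n * (@chi M t n)^* = cis th ^+ n.
  by rewrite cis_conj -cisD cisX; congr cis; rewrite /th; field.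
under eq_bigr do rewrite wE.
have w1 : cis th != 1.
  apply: cis_neq1; rewrite /th !normrM normfV !normr_nat (gtr0_norm (pi_gt0 R)).
  have Mgt0 : 0 < M%:R :> R by rewrite ltr0n.
  have tu0 : 0 < `|(t : nat)%:R - (u : nat)%:R : R|.
    by rewrite normr_gt0 subr_eq0 eqr_nat.
  have tuM : `|(t : nat)%:R - (u : nat)%:R : R| < M%:R.
    have tM : (t : nat)%:R < M%:R :> R by rewrite ltr_nat ltn_ord.
    have uM : (u : nat)%:R < M%:R :> R by rewrite ltr_nat ltn_ord.
    have t0 : 0 <= (t : nat)%:R :> R by [].
    have u0 : 0 <= (u : nat)%:R :> R by [].
    by rewrite ltr_norml; lra.
  rewrite divr_gt0 ?mulr_gt0 ?pi_gt0//= ltr_pdivrMr// ltr_pM2l//.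
  by rewrite mulr_gt0// pi_gt0.
have wM : cis th ^+ M = 1.
  rewrite cisX (_ : th * _ = 2 * pi * (t : nat)%:R - 2 * pi * (u : nat)%:R).
    by rewrite cisD -cis_conj !cis_2pi_nat mul1r rmorph1.
  by rewrite /th; field.
apply: (mulfI (_ : cis th - 1 != 0)); first by rewrite subr_eq0.
by rewrite mulr0 -(subrX1 (cis th) M) wM subrr.
Qed.

End Characters.

(** * Mean and second moment of weighted character sums *)

Section KernelSums.
Context {R : realType} {N : nat}.
Hypothesis N1 : (1 < N)%N.
Variable S : {set 'Z_N}.
Implicit Types (c : 'Z_N -> R[i]) (t u n : 'Z_N).

(** Summation over [n] in [A] yields the combination of the entries k(t, u) with coefficients
    [c t]. *)
Definition kernel_sum c u n : R[i] :=
  chi u n * \sum_(t in S) c t * (chi t n)^*.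

Lemma sum_kernel_sum c u :
  \sum_n kernel_sum c u n = if u \in S then N%:R * c u else 0.
Proof.
rewrite /kernel_sum; under eq_bigr do rewrite mulr_sumr.
rewrite exchange_big/=.
under eq_bigr => t _.
  under eq_bigr do rewrite mulrCA.
  rewrite -mulr_sumr chi_orthogonal//.
  over.
case: ifPn => uS.
  rewrite (bigD1 u uS)/= [X in _ + X]big1 => [|t /andP[_ /negbTE ->]].
    by rewrite addr0 (eqxx u) [LHS]mulrC.
  by rewrite mulr0.
rewrite big1// => t tS; case: eqVneq => [tu|]; last by rewrite mulr0.
by rewrite -tu tS in uS.
Qed.

(** Parseval's identity: the factor [chi u n] has modulus 1, and orthogonality kills the
    off-diagonal terms of the expanded square. *)
Lemma sum_normc_kernel_sum_sqr c u :
  \sum_n normc (kernel_sum c u n) ^+ 2 = N%:R * \sum_(t in S) normc (c t) ^+ 2.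
Proof.
apply: complexI; rewrite rmorphM/= !rmorph_sum/= rmorph_nat.
transitivity (\sum_n \sum_(t in S) \sum_(v in S)
    (c t * (c v)^*) * (chi v n * (chi t n)^*)).
  apply: eq_bigr => n _.
  rewrite normc_sqr /kernel_sum rmorphM/= mulrACA chi_conj mul1r rmorph_sum/=.
  rewrite mulr_suml; apply: eq_bigr => t _.
  rewrite mulr_sumr; apply: eq_bigr => v _.
  by rewrite rmorphM/= conjCK; ring.
rewrite exchange_big/= mulr_sumr; apply: eq_bigr => t tS.
rewrite exchange_big/= (bigD1 t)//= -mulr_sumr chi_orthogonal// eqxx.
rewrite big1 ?addr0 => [|v /andP[_ /negbTE vt]].
  by rewrite normc_sqr mulrC.
by rewrite -mulr_sumr chi_orthogonal// eq_sym vt mulr0.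
Qed.

Variables (c : 'Z_N -> R[i]) (u : 'Z_N) (k : R).
Hypotheses (k1 : 1 <= k) (ck : forall t, normc (c t) <= k).

Lemma Re_kernel_sum_le n : `|complex.Re (kernel_sum c u n)| <= #|S|%:R * k.
Proof.
apply: le_trans (Re_le_normc _) _.
rewrite normcM normc_cis mul1r; apply: le_trans (normc_sum _ _ _) _.
rewrite -[#|S|]sum1_card natr_sum mulr_suml; apply: ler_sum => t _.
by rewrite normcM normc_conj normc_cis mulr1 mul1r.
Qed.

Lemma sum_Re_kernel_sum_sqr :
  \sum_n complex.Re (kernel_sum c u n) ^+ 2 <= N%:R * (#|S|%:R * k ^+ 2).
Proof.
apply: (@le_trans _ _ (\sum_n normc (kernel_sum c u n) ^+ 2)).
  apply: ler_sum => n _.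
  by rewrite -real_normK ?num_real// lerXn2r ?nnegrE ?normc_ge0// Re_le_normc.
rewrite sum_normc_kernel_sum_sqr ler_wpM2l//.
rewrite -[#|S|]sum1_card natr_sum mulr_suml; apply: ler_sum => t _.
by rewrite mul1r lerXn2r ?nnegrE ?normc_ge0 ?ck// (le_trans _ k1).
Qed.

End KernelSums.

(** * A deterministic criterion for the null space property *)

Section NullSpace.
Context {R : realType} {N : nat}.
Hypothesis N1 : (1 < N)%N.
Variables (S A : {set 'Z_N}).

Definition kernel (t u : 'Z_N) : R[i] := \sum_(n in A) chi u n * (chi t n)^*.

Lemma kernel_diag u : kernel u u = #|A|%:R.
Proof.
by rewrite /kernel; under eq_bigr do rewrite chi_conj; rewrite sumr_const.
Qed.

Lemma dft_eq0 (z : {ffun 'Z_N -> R[i]}) n :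
  dft z n = 0 -> \sum_u z u * chi u n = 0.
Proof.
move/eqP; rewrite mulf_eq0 => /orP[/eqP[]/eqP|/eqP//].
by rewrite invr_eq0 sqrtr_eq0 lern0 eqn0Ngt (ltnW N1).
Qed.

Lemma kernel_annihilates (z : {ffun 'Z_N -> R[i]}) t :
  (forall n, n \in A -> dft z n = 0) -> \sum_u z u * kernel t u = 0.
Proof.
move=> z0; under eq_bigr do rewrite mulr_sumr.
rewrite exchange_big/= big1// => n nA.
under eq_bigr do rewrite mulrA.
by rewrite -mulr_suml dft_eq0 ?mul0r// z0.
Qed.

(* Summing over t in S the bound
   #|A| |z t| <= sum_(u != t) |kernel t u| |z u| coming from
   kernel_annihilates, the hypothesis compares the two sides
   coefficient by coefficient. *)
Lemma kernel_null_space_property (a : R) : 0 < a ->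
  (forall u, \sum_(t in S | t != u) normc (kernel t u) -
     (if u \in S then #|A|%:R else 0) < if u \in S then - a else a) ->
  null_space_property R S A.
Proof.
move=> a0 hyp z z_neq0 zA.
pose coef u : R := \sum_(t in S | t != u) normc (kernel t u) -
     (if u \in S then #|A|%:R else 0).
have ge0 : 0 <= \sum_u normc (z u) * coef u.
  rewrite /coef; under eq_bigr do rewrite mulrBr mulr_sumr.
  rewrite sumrB (exchange_big_dep (mem S))//=; last by move=> u t _ /andP[].
  have -> : \sum_u normc (z u) * (if u \in S then #|A|%:R else 0) =
      \sum_(t in S) normc (z t) * #|A|%:R.
    by rewrite [RHS]big_mkcond; apply: eq_bigr => u _; case: ifP; rewrite ?mulr0.
  rewrite -sumrB sumr_ge0// => t tS; rewrite subr_ge0.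
  have := kernel_annihilates t zA.
  rewrite (bigD1 t)//= kernel_diag => /eqP; rewrite addr_eq0 => /eqP zt.
  have -> : normc (z t) * #|A|%:R = normc (z t * #|A|%:R).
    rewrite normcM; congr (_ * _).
    by rewrite -(rmorph_nat (real_complex R))/= expr0n addr0 sqrtr_sqr ger0_norm.
  rewrite zt normcN; apply: le_trans (normc_sum _ _ _) _.
  rewrite tS/=; under eq_bigl do rewrite eq_sym.
  by apply: ler_sum => u _; rewrite normcM.
have [v zv] : exists v, z v != 0.
  apply/existsP; apply: contraNT z_neq0 => /existsPn h.
  by apply/eqP/ffunP => v; rewrite ffunE; have /negPn/eqP := h v.
have zv0 : 0 < normc (z v).
  by rewrite lt_def normc_ge0 andbT; apply: contra zv => /eqP/eq0_normc ->.
(* Strictness comes from the single point [v] where [z] does not vanish. *)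
have lt : \sum_u normc (z u) * coef u <
    \sum_u normc (z u) * (if u \in S then - a else a).
  rewrite (bigD1 v)//= [ltRHS](bigD1 v)//= ltr_leD//.
    by rewrite ltr_pM2l// hyp.
  by apply: ler_sum => u _; rewrite ler_wpM2l ?normc_ge0// ltW// hyp.
have := le_lt_trans ge0 lt; rewrite (bigID (mem S))/=.
under eq_bigr => u uS do rewrite uS mulrN.
under [X in _ + X]eq_bigr => u uS do rewrite (negbTE uS).
rewrite sumrN -!mulr_suml addrC subr_gt0 ltr_pM2r// => lt'.
rewrite -[X in X < _](rmorph_sum (real_complex R)).
rewrite -[X in _ < X](rmorph_sum (real_complex R)) /= ltcR.
by under [ltRHS]eq_bigl do rewrite finset.inE.
Qed.

End NullSpace.

(** * Finitely many bad events and the union bound *)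

Section BadEvents.
Context {R : realType} {N : nat}.
Hypothesis N1 : (1 < N)%N.
Variables (S : {set 'Z_N}) (D : finType) (e : D -> R[i]).
Hypothesis e_norming : forall w, exists i, normc w <= complex.Re (e i * w).

(* The value -1 at t = u contributes - k(u, u) = - |A| to the sum, which puts
   both kinds of points u in the same form. *)
Definition net_coef (x : {ffun 'Z_N -> D}) (u t : 'Z_N) : R[i] :=
  if t == u then - 1 else e (x t).

Definition net_sum x u n : R := complex.Re (kernel_sum S (net_coef x u) u n).

Lemma net_sum_null_space_property (d0 : D) (A : {set 'Z_N}) (a : R) : 0 < a ->
  (forall u (x : {ffun 'Z_N -> D}), x \in pffun_on d0 S predT ->
     \sum_(n in A) net_sum x u n < if u \in S then - a else a) ->
  null_space_property R S A.
Proof.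
move=> a0 good; apply: (kernel_null_space_property N1 a0) => u.
have [i iP] := choice (fun t => e_norming (kernel A t u)).
(* The default [d0] outside [S] leaves only [#|D| ^ #|S|] functions to consider, a number
   independent of [N]. *)
pose x : {ffun 'Z_N -> D} := [ffun t => if t \in S then i t else d0].
have xW : x \in pffun_on d0 S predT.
  apply/pffun_onP; split => //; apply/fintype.subsetP => t.
  by rewrite !inE ffunE; case: ifP => //; rewrite eqxx.
apply: le_lt_trans (good u x xW).
have -> : \sum_(n in A) net_sum x u n =
    \sum_(t in S) complex.Re (net_coef x u t * kernel A t u).
  rewrite -!Re_sum; congr complex.Re; rewrite /kernel_sum.
  under eq_bigr do rewrite mulr_sumr.
  rewrite exchange_big/=; apply: eq_bigr => t _.
  by rewrite mulr_sumr; apply: eq_bigr => n _; rewrite mulrCA.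
have le_off : \sum_(t in S | t != u) normc (kernel A t u) <=
    \sum_(t in S | t != u) complex.Re (net_coef x u t * kernel A t u).
  apply: ler_sum => t /andP[tS /negbTE tu].
  by rewrite /net_coef tu ffunE tS.
case: ifPn => uS; last first.
  rewrite subr0; apply: le_trans le_off _.
  rewrite [leRHS](bigID (fun t => t != u))/= lerDl big1// => t.
  by rewrite negbK => /andP[tS /eqP tu]; rewrite -tu tS in uS.
rewrite [leRHS](bigD1 u)//= addrC lerD//.
by rewrite /net_coef eqxx kernel_diag mulN1r -(rmorph_nat (real_complex R)).
Qed.

Context {d : measure_display} {T : measurableType d}.
Variables (P : probability T R) (tau : R) (X : T -> {set 'Z_N}).
Hypothesis rX : random_selection P tau X.
Variables (k v : R).
Hypotheses (k1 : 1 <= k) (ek : forall i, normc (e i) <= k) (v0 : 0 < v)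
  (kv : #|S|%:R * k ^+ 2 <= v).

(** The mean is [- tau * N] for [u] in [S] and 0 otherwise, so in both cases the threshold exceeds
    it by [b * tau * N]. *)
Lemma net_sum_deviation x u (b : R) : 0 <= b <= 1 ->
  \sum_(A : {set 'Z_N} | (if u \in S then b - 1 else b) * (tau * N%:R) <=
      \sum_(n in A) net_sum x u n) law P X A <=
  expR (- (b ^+ 2 * (tau * N%:R) / (3 * v))).
Proof.
move=> /andP[b0 b1]; have [/andP[tau0 _] mX PX indX] := rX.
have ck t : normc (net_coef x u t) <= k.
  by rewrite /net_coef; case: eqP => // _; rewrite normcN normc1.
(* This value minimises [3 / 4 * l ^+ 2 * v - l * b]; as [b <= 1], it also gives [l * v <= 2 / 3],
   the range of the quadratic bound on [expR]. *)
pose l := 2 * b / (3 * v).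
have l0 : 0 <= l by rewrite divr_ge0 ?mulr_ge0// ltW.
have lf n : l * net_sum x u n <= 2 / 3.
  apply: (@le_trans _ _ (l * v)).
    rewrite ler_wpM2l//; apply: le_trans (ler_norm _) _.
    apply: le_trans (Re_kernel_sum_le S u ck n) _.
    apply: le_trans kv; rewrite ler_wpM2l// expr2 ler_peMl//.
    by apply: le_trans k1.
  have -> : l * v = 2 / 3 * b by rewrite /l; field; rewrite gt_eqF.
  by rewrite ler_piMr.
apply: le_trans (law_chernoff mX PX indX _ tau0 l0 lf) _.
rewrite ler_expR -Re_sum sum_kernel_sum//.
have -> : complex.Re (if u \in S then N%:R * net_coef x u u else 0) =
    if u \in S then - N%:R else 0 :> R.
  case: ifP => // _; rewrite /net_coef eqxx mulrN1.
  by rewrite -(rmorph_nat (real_complex R)).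
have sq : \sum_n net_sum x u n ^+ 2 <= N%:R * v.
  apply: le_trans (sum_Re_kernel_sum_sqr N1 S u k1 ck) _.
  by rewrite ler_wpM2l.
apply: (@le_trans _ _ (tau * (3 / 4 * l ^+ 2 * (N%:R * v)) -
    l * b * (tau * N%:R))).
  have : 3 / 4 * l ^+ 2 * \sum_n net_sum x u n ^+ 2 <=
      3 / 4 * l ^+ 2 * (N%:R * v).
    by rewrite ler_wpM2l// mulr_ge0// sqr_ge0.
  rewrite -(ler_pM2l tau0) => h.
  by case: ifP => _; lra.
rewrite /l le_eqVlt; apply/orP; left; apply/eqP; field.
by rewrite gt_eqF.
Qed.

Lemma law_not_null_space_property (d0 : D) (a p q : R) : 0 < a <= 1 ->
  expR (- (a ^+ 2 * (tau * N%:R) / (3 * v))) <= p ->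
  expR (- ((1 - a) ^+ 2 * (tau * N%:R) / (3 * v))) <= q ->
  \sum_(A : {set 'Z_N} | ~~ `[< null_space_property R S A >]) law P X A <=
  (#|D| ^ #|S|)%:R * (N%:R * p + #|S|%:R * q).
Proof.
move=> /andP[a0 a1] hp hq; have [/andP[tau0 _] _ _ _] := rX.
have N0 : 0 < N%:R :> R by rewrite ltr0n; apply: ltnW.
have tN : 0 < tau * N%:R by rewrite mulr_gt0.
pose b u := if u \in S then 1 - a else a.
pose bad (y : 'Z_N * {ffun 'Z_N -> D}) (A : {set 'Z_N}) :=
  (if y.1 \in S then b y.1 - 1 else b y.1) * (tau * N%:R) <=
      \sum_(n in A) net_sum y.2 y.1 n.
pose W := pffun_on d0 S predT.
(* Union bound: a set without the null space property is counted by at least one pair [(u, x)]. *)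
apply: (@le_trans _ _
  (\sum_A \sum_(y | (y.2 \in W) && bad y A) law P X A)).
  rewrite big_mkcond; apply: ler_sum => A _.
  have nonneg : 0 <= \sum_(y | (y.2 \in W) && bad y A) law P X A.
    by apply: sumr_ge0 => *; apply: law_ge0.
  case: ifPn => // nsp.
  have [y yP] : exists y, (y.2 \in W) && bad y A.
    apply/existsP; apply: contraNT nsp => /existsPn good; apply/asboolP.
    apply: (@net_sum_null_space_property d0 A (a * (tau * N%:R))) => [|u x xW].
      by rewrite mulr_gt0.
    have := good (u, x); rewrite /= xW /bad /b/= -ltNge.
    by case: (u \in S); rewrite // addrAC subrr add0r mulNr.
  rewrite (bigD1 y)//= lerDl sumr_ge0// => *; exact: law_ge0.
rewrite (exchange_big_dep (fun y => y.2 \in W))/=; last first.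
  by move=> A y _ /andP[].
apply: (@le_trans _ _ (\sum_(y : 'Z_N * {ffun 'Z_N -> D} | y.2 \in W)
    if y.1 \in S then q else p)).
  apply: ler_sum => -[u x]/= xW; rewrite xW/=.
  apply: le_trans (net_sum_deviation _ _ _) _.
    by rewrite /b; case: ifP => _; lra.
  by rewrite /b; case: ifP.
(* The number of points outside [S] is bounded crudely by [N]. *)
rewrite -(pair_big predT (mem W) (fun u x => if u \in S then q else p))/=.
under eq_bigr do rewrite sumr_const card_pffun_on cardT -cardE.
rewrite sumrMnl -[leLHS]mulr_natl ler_wpM2l// (bigID (mem S))/=.
rewrite (eq_bigr (fun=> q)) => [|u ->//].
rewrite [X in _ + X](eq_bigr (fun=> p)) => [|u /negbTE ->//].
have p0 : 0 <= p by apply: le_trans hp; apply: expR_ge0.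
rewrite !sumr_const -[q *+ _]mulr_natl -[p *+ _]mulr_natl addrC lerD2r ler_wpM2r//.
rewrite ler_nat; apply: leq_trans (max_card _) _.
by rewrite card_ord Zp_cast.
Qed.

End BadEvents.

Theorem mainTheorem6 (R : realType) (s : nat) (C delta : R)
    (hs : (1 <= s)%N) (hC : 1 < C)
    (hdelta : delta < (C - 1) ^+ 2 / (4 * C)) :
  exists (A : R) (N0 : nat),
    forall (N : nat) (d : measure_display) (T : measurableType d)
           (P : probability T R) (S : {set 'Z_N}) (tau : R)
           (Omega : T -> {set 'Z_N}),
      (N0 <= N)%N -> (1 < N)%N -> #|S| = s ->
      tau * N%:R = (3 * s + 2)%:R * C * ln (N%:R : R) ->
      random_selection P tau Omega ->
      ((1 - A * (N%:R : R) `^ (- delta))%:E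
         <= P [set x | null_space_property R S (Omega x)])%E.
Proof.
pose sR : R := s%:R; have sR1 : 1 <= sR by rewrite ler1n.
(* With [eta = 1 / (6 * s)], [s * (1 + eta) ^+ 2 = s + 1 / 3 + 1 / (36 * s)] is at most
   [v = s + 2 / 3], and [3 * v = 3 * s + 2] is the factor in the expected size. *)
have eta0 : 0 < (6 * sR)^-1 by rewrite invr_gt0; lra.
have [D [e [/card_gt0P[d0 _] [ek enorm]]]] := finite_norming_set eta0.
pose K : R := (#|D| ^ s)%:R.
(* The bound holds for every [N > 1], hence the threshold 0. *)
exists (K * (1 + sR)), 0%N => N d T P S tau X _ N1 Ss tauN rX.
have NR1 : 1 < N%:R :> R by rewrite ltr1n.
have lnN : 0 < ln (N%:R : R) by rewrite ln_gt0.
pose v : R := sR + 2 / 3.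
have kv : #|S|%:R * (1 + (6 * sR)^-1) ^+ 2 <= v.
  rewrite Ss -/sR /v [leLHS](_ : _ = sR + 1 / 3 + 1 / 36 * sR^-1); last first.
    by field; rewrite gt_eqF//; lra.
  have : sR^-1 <= 1 by rewrite invf_le1//; lra.
  by lra.
have v0 : 0 < v by rewrite /v; lra.
have devE (b : R) : b ^+ 2 * (tau * N%:R) / (3 * v) = C * b ^+ 2 * ln N%:R.
  rewrite tauN natrD natrM -/sR /v; field.
  by rewrite gt_eqF//; lra.
pose delta0 := (C - 1) ^+ 2 / (4 * C).
(* The solution of [C * a ^+ 2 - 1 = C * (1 - a) ^+ 2], which balances the two contributions. *)
pose a := (C + 1) / (2 * C).
have C0 : C != 0 by rewrite gt_eqF//; lra.
have a01 : 0 < a <= 1.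
  by rewrite divr_gt0/= ?ler_pdivrMr ?mul1r//; lra.
have Ca : C * a ^+ 2 = 1 + delta0 by rewrite /a /delta0; field.
have Cb : C * (1 - a) ^+ 2 = delta0 by rewrite /a /delta0; field.
have k1 : 1 <= 1 + (6 * sR)^-1 by rewrite lerDl ltW.
set q := expR (- (delta0 * ln N%:R)).
have := law_not_null_space_property N1 enorm rX k1 ek v0 kv d0 a01
  (p := N%:R^-1 * q) (q := q).
rewrite !devE Ca Cb Ss -/K -/sR => /(_ _ (lexx _)).
(* The factor [N%:R^-1] cancels the number of points outside [S]. *)
have -> : N%:R^-1 * q = expR (- ((1 + delta0) * ln N%:R)).
  by rewrite mulrDl mul1r opprD expRD expRN lnK// posrE; lra.
move=> /(_ (lexx _)).
rewrite mulrDl mul1r opprD expRD expRN lnK ?posrE; last lra.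
rewrite mulrA mulfV ?mul1r; last by rewrite gt_eqF//; lra.
rewrite -/q => bad.
have [_ mX PX indX] := rX.
have -> : [set x | null_space_property R S (X x)] =
    [set x | `[< null_space_property R S (X x) >]].
  by apply/seteqP; split => x /=; [move=> /asboolP|move=> /asboolP].
rewrite (law_pred P mX (fun A => `[< null_space_property R S A >])) lee_fin.
have := law_total mX PX indX.
rewrite (bigID (fun A => `[< null_space_property R S A >]))/= => tot.
(* Here [delta < delta0] is used, together with [ln N > 0]. *)
have qd : q <= N%:R `^ (- delta).
  rewrite /powR gt_eqF/=; last by lra.
  by rewrite ler_expR mulNr lerN2 ler_pM2r// ltW.
rewrite lerBlDr -[leLHS]tot lerD2l; apply: le_trans bad _.
rewrite -[q in q + _]mul1r -mulrDl mulrA ler_wpM2l//.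
by rewrite mulr_ge0// addr_ge0//; lra.
Qed.
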